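(* Let $M_\infty$ be equipped with its norm topology. The set $$\{(\boldsymbol f,x)\in M_\infty\times K:\ \liminf_{n\to\infty} f_n(x)<\limsup_{n\to\infty} f_n(x)\}$$ is a comeager $G_{\delta\sigma}$ subset (i.e. it is comeager and is a countable union of $G_\delta$ sets) of $M_\infty\times K$. In particular, there is a comeager subset of $M_\infty$ such that for every $\boldsymbol f$ in it one has $\liminf_n f_n(x)<\limsup_n f_n(x)$ for all $x$ from a comeager subset of $K$ (depending on $\boldsymbol f$).
   Context: Setting: $(\Omega,\Sigma,P)$ is a probability space and $(\Sigma_n)_{n\in\mathbb N}$ is a filtration of finite $\sigma$-algebras, i.e. an increasing sequence of finite $\sigma$-subalgebras of $\Sigma$. For each $n$, $\mathcal D_n$ is the finite partition of $\Omega$ (into nonempty sets) generating $\Sigma_n$; thus $\mathcal D_m$ refines $\mathcal D_n$ for $m\ge n$. Standing assumptions: (1) $P(D)>0$ for each $n\in\mathbb N$ and $D\in\mathcal D_n$; (2) for each $n\in\mathbb N$ and $D\in\mathcal D_n$ there is $m>n$ with $D\notin\mathcal D_m$. The space $K$: $K=\{(D_n)\in\prod_{n\in\mathbb N}\mathcal D_n : D_m\subset D_n \text{ for } m\ge n\}$, with the topology inherited from the product, each $\mathcal D_n$ being discrete (a metrizable compact space). Martingales: a martingale (adapted to $(\Sigma_n)$) is a sequence $\boldsymbol f=(f_n)$ with $f_n\in L^1(\Omega,\Sigma_n,P|_{\Sigma_n})$ and $\int_E f_n\,dP=\int_E f_m\,dP$ whenever $n\le m$ and $E\in\Sigma_n$.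 Each $f_n$ is constant on each $D\in\mathcal D_n$; that value is denoted $f_n(D)$. For $x=(D_k)_{k}\in K$ we write $f_n(x)=f_n(D_n)$. Spaces: $M_\infty$ is the Banach space of all martingales adapted to $(\Sigma_n)$ with $\|\boldsymbol f\|_\infty=\sup_n\|f_n\|_{L^\infty}<\infty$. *)

(* Defs.v *)
From HB Require Import structures.
From mathcomp Require Import all_boot all_order all_algebra.
From mathcomp Require Import all_classical all_reals all_analysis.
From mathcomp Require Import measurable_realfun ess_sup_inf borel_hierarchy.

Set Implicit Arguments.
Unset Strict Implicit.
Unset Printing Implicit Defensive.

Import Order.TTheory GRing.Theory Num.Theory.
Import numFieldNormedType.Exports.

Local Open Scope classical_set_scope.
Local Open Scope ring_scope.

Section category.
Context {X : topologicalType}.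
Implicit Type A : set X.

Definition nowhere_dense A := (closure A)° = set0.

Definition meager A :=
  exists2 N : (set X)^nat, (forall i, nowhere_dense (N i)) & A = \bigcup_i N i.

Definition comeager A := meager (~` A).

Definition Gdelta_sigma A :=
  exists2 G : (set X)^nat, (forall i, Gdelta (G i)) & A = \bigcup_i G i.

End category.

(* The last two fields are the standing assumptions: no null cells, and every
   cell is eventually split. *)
Record finite_filtration d (T : measurableType d) (R : realType)
    (P : probability T R) := FiniteFiltration {
  salg : nat -> set (set T) ;
  salg_sigma_algebra : forall n, sigma_algebra [set: T] (salg n) ;
  salg_finite : forall n, finite_set (salg n) ;
  salg_measurable : forall n, salg n `<=` measurable ;
  salg_incr : forall n m, (n <= m)%N -> salg n `<=` salg m ;
  cells : nat -> set (set T) ;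
  cells_finite : forall n, finite_set (cells n) ;
  cells_partition : forall n, partition (cells n) id [set: T] ;
  cells_generate : forall n, <<s cells n >> = salg n ;
  cells_gt0 : forall n D, cells n D -> (0 < P D)%E ;
  cells_split : forall n D, cells n D -> exists2 m, (n < m)%N & ~ cells m D }.

Section branches.
Context d (T : measurableType d) (R : realType) (P : probability T R).
Variable F : finite_filtration P.

Definition cell_product : topologicalType :=
  prod_topology (fun n => discrete_topology (cells F n)).

Definition cell_at (x : cell_product) n : set T := set_val (x n : cells F n).

Definition branch_set : set cell_product :=
  [set x | forall n m, (n <= m)%N -> cell_at x m `<=` cell_at x n].

(* [set_type] carries the topology induced by the ambient space. *)
Definition branches : topologicalType := set_type branch_set.

Definition branch_cell (x : branches) n : set T := cell_at (set_val x) n.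

End branches.

Section martingales.
Context d (T : measurableType d) (R : realType) (P : probability T R).
Variable F : finite_filtration P.
Implicit Type f : nat -> T -> R.

(* Cells have positive probability, so the only null set of the n-th
   sigma-algebra is empty and an element of its L^1 space is represented by
   exactly one function. *)
Definition martingale f :=
  [/\ forall n,
        measurable_fun [set: g_sigma_algebraType (salg F n)] (f n),
      forall n, P.-integrable [set: T] (EFin \o f n)
    & forall n m E, (n <= m)%N -> salg F n E ->
        (\int[P]_(t in E) (f n t)%:E = \int[P]_(t in E) (f m t)%:E)%E].

Definition sup_norm f : \bar R :=
  ereal_sup [set 'N[P]_+oo[EFin \o f n]%E | n in [set: nat]].

Definition bounded_martingale : {pred nat -> T -> R} :=
  mem [set f | martingale f /\ (sup_norm f < +oo)%E].

Record Minfty := MInfty {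
  mart :> nat -> T -> R ;
  mart_bounded : mart \in bounded_martingale }.

HB.instance Definition _ := [isSub for mart].
HB.instance Definition _ := [Choice of Minfty by <:].

Lemma bounded_martingaleP f :
  (f \in bounded_martingale) <-> martingale f /\ (sup_norm f < +oo)%E.
Proof. by rewrite inE. Qed.

Lemma salg_measurable_fun n (g : T -> R) :
  measurable_fun [set: g_sigma_algebraType (salg F n)] g ->
  measurable_fun [set: T] g.
Proof.
move=> mg _ B mB; apply: (@salg_measurable _ _ _ _ F n).
have := mg measurableT B mB.
by rewrite /measurable/= (sigma_algebra_id (salg_sigma_algebra F n)).
Qed.

Lemma Lnormy_cst0 : 'N[P]_+oo[EFin \o (cst 0%R : T -> R)]%E = 0%E.
Proof. by rewrite -[X in Lnorm _ _ X]/(cst 0%E) Lnorm0. Qed.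

Lemma Lnormy_scale (a : R) (g : T -> R) :
  ('N[P]_+oo[EFin \o (a *: g)%R] = `|a|%:E * 'N[P]_+oo[EFin \o g])%E.
Proof.
have P0 : (0 < P [set: T])%E by rewrite probability_setT.
rewrite unlock /Lnorm P0 -ess_supZl//.
by apply/eq_ess_sup/nearW => t /=; rewrite normrM EFinM.
Qed.

Lemma sup_norm_ge0 f : (0 <= sup_norm f)%E.
Proof.
apply: (le_trans (@Lnorm_ge0 _ _ _ P +oo%E (EFin \o f 0%N))).
by apply: ereal_sup_ubound; exists 0%N.
Qed.

Lemma sup_normD f g : martingale f -> martingale g ->
  (sup_norm (f + g)%R <= sup_norm f + sup_norm g)%E.
Proof.
move=> [mf _ _] [mg _ _]; apply: ge_ereal_sup => _ [n _ <-].
apply: (le_trans (eminkowski _ (salg_measurable_fun (mf n))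
  (salg_measurable_fun (mg n)) _)); first by rewrite leey.
by apply: leeD; apply: ereal_sup_ubound; exists n.
Qed.

Lemma sup_norm_scale_le (a : R) f :
  (sup_norm (a *: f)%R <= `|a|%:E * sup_norm f)%E.
Proof.
apply: ge_ereal_sup => _ [n _ <-].
rewrite Lnormy_scale lee_wpmul2l ?lee_fin//.
by apply: ereal_sup_ubound; exists n.
Qed.

Lemma martingale_lin (a : R) f g :
  martingale f -> martingale g -> martingale (a *: f + g).
Proof.
move=> [mf If Ef] [mg Ig Eg].
have Ia n : P.-integrable [set: T] (fun t => (a%:E * (f n t)%:E)%E).
  exact: (integrableZl measurableT a (If n)).
split.
- move=> n; have mc := @measurable_cst _ _ (g_sigma_algebraType (salg F n)) _
    setT a.
  exact: (measurable_funD (measurable_funM mc (mf n)) (mg n)).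
- by move=> n; exact: (integrableD measurableT (Ia n) (Ig n)).
- move=> n m E nm En.
  have mE : measurable E := @salg_measurable _ _ _ _ F n _ En.
  have sub h : P.-integrable [set: T] h -> P.-integrable E h.
    exact: integrableS.
  have lin k : (\int[P]_(t in E) ((a *: f + g)%R k t)%:E =
      a%:E * \int[P]_(t in E) (f k t)%:E + \int[P]_(t in E) (g k t)%:E)%E.
    rewrite -(integralZl mE (sub _ (If k))).
    by rewrite -(integralD mE (sub _ (Ia k)) (sub _ (Ig k))).
  by rewrite !lin (Ef n m E)// (Eg n m E).
Qed.

Lemma martingale0 : martingale 0.
Proof.
split=> [n|n|n m E _ _].
- exact: measurable_cst.
- exact: integrable0.
- by [].
Qed.

Lemma bounded_martingale_submod_closed : submod_closed bounded_martingale.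
Proof.
split.
  apply/bounded_martingaleP; split; first exact: martingale0.
  apply: (@le_lt_trans _ _ 0%E); last exact: ltry.
  by apply: ge_ereal_sup => _ [n _ <-]; rewrite Lnormy_cst0.
move=> a f g /bounded_martingaleP[mf bf] /bounded_martingaleP[mg bg].
apply/bounded_martingaleP; split; first exact: martingale_lin.
have maf : martingale (a *: f).
  by rewrite -[a *: f]addr0; apply: martingale_lin => //; exact: martingale0.
apply: (le_lt_trans (sup_normD maf mg)); apply: lte_add_pinfty => //.
apply: (le_lt_trans (sup_norm_scale_le _ _)).
by apply: lte_mul_pinfty => //; rewrite lee_fin.
Qed.

HB.instance Definition _ := GRing.isSubmodClosed.Build _ _ bounded_martingale
  bounded_martingale_submod_closed.
HB.instance Definition _ := [SubChoice_isSubLmodule of Minfty by <:].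

Lemma cells_salg n D : cells F n D -> salg F n D.
Proof. by move=> nD; rewrite -cells_generate; exact: sub_sigma_algebra. Qed.

Lemma salg_cells n E D : salg F n E -> cells F n D ->
  D `<=` E \/ D `<=` ~` E.
Proof.
move=> En nD; move: E En; rewrite -cells_generate.
apply: smallest_sub => [|A nA]; last first.
  have [_ tr _] := cells_partition F n.
  have [->|DA] := pselect (D = A); first by left.
  right=> t Dt At; apply: DA; apply: (tr D A nD nA).
  by exists t.
split.
- by right=> t _ [].
- move=> A [DA|DA]; [right=> t Dt [_] | left=> t Dt; split => //];
    by [apply; exact: DA | exact: DA].
- move=> A DA; have [[i Ai]|nAi] := pselect (exists i, D `<=` A i).
    by left=> t Dt; exists i => //; exact: Ai.
  right=> t Dt [i _ Ait]; have [Ai|/(_ t Dt)//] := DA i.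
  by apply: nAi; exists i.
Qed.

Lemma martingale_cell_const f n D s t :
  martingale f -> cells F n D -> D s -> D t -> f n s = f n t.
Proof.
move=> [mf _ _] nD Ds Dt.
have fn : salg F n (f n @^-1` [set f n s]).
  have := mf n measurableT [set f n s] (measurable_set1 _).
  by rewrite /measurable/= (sigma_algebra_id (salg_sigma_algebra F n)) setTI.
by have [/(_ t Dt)/esym|/(_ s Ds)/=] := salg_cells fn nD.
Qed.

Lemma martingale_ae_eq0 f n :
  martingale f -> {ae P, forall t, f n t = 0} -> f n = cst 0.
Proof.
move=> mf f0; apply/funext => t /=; apply: contrapT => ft0.
have [cov _ _] := cells_partition F n.
have [D nD Dt] : cover (cells F n) id t by rewrite cov.
have mD := @salg_measurable _ _ _ _ F n _ (cells_salg nD).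
have := cells_gt0 nD; rewrite lt0e => /andP[/eqP + _]; apply.
apply/(negligibleP P mD); apply: negligibleS f0 => s Ds /= fs0.
by apply: ft0; rewrite (martingale_cell_const mf nD Dt Ds).
Qed.

Definition Minfty_norm (f : Minfty) : R := fine (sup_norm f).

Lemma Minfty_normE (f : Minfty) : (Minfty_norm f)%:E = sup_norm f.
Proof.
have /bounded_martingaleP[_ bf] := mart_bounded f.
by rewrite fineK// ge0_fin_numE// sup_norm_ge0.
Qed.

Lemma martD (f g : Minfty) : mart (f + g) = mart f + mart g.
Proof. by []. Qed.

Lemma martZ (a : R) (f : Minfty) : mart (a *: f) = a *: mart f.
Proof. by []. Qed.

Lemma Minfty_normD (f g : Minfty) :
  Minfty_norm (f + g) <= Minfty_norm f + Minfty_norm g.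
Proof.
rewrite -lee_fin EFinD !Minfty_normE martD.
have /bounded_martingaleP[mf _] := mart_bounded f.
have /bounded_martingaleP[mg _] := mart_bounded g.
exact: sup_normD.
Qed.

Lemma Minfty_normZ (a : R) (f : Minfty) :
  Minfty_norm (a *: f) = `|a| * Minfty_norm f.
Proof.
have le1 (b : R) (g : Minfty) : Minfty_norm (b *: g) <= `|b| * Minfty_norm g.
  rewrite -lee_fin EFinM !Minfty_normE martZ.
  exact: sup_norm_scale_le.
apply/eqP; rewrite eq_le le1/=; have [->|a0] := eqVneq a 0.
  by rewrite normr0 mul0r fine_ge0// sup_norm_ge0.
have := le1 a^-1 (a *: f); rewrite scalerA mulVf// scale1r normfV.
by rewrite ler_pdivlMl ?normr_gt0.
Qed.

Lemma Minfty_norm_eq0 (f : Minfty) : Minfty_norm f = 0 -> f = 0.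
Proof.
have /bounded_martingaleP[mf _] := mart_bounded f.
move=> f0; apply/val_inj/funext => n; apply: martingale_ae_eq0 => //.
have fn0 : 'N[P]_+oo[EFin \o mart f n]%E = 0%E.
  apply/eqP; rewrite eq_le Lnorm_ge0 andbT.
  rewrite -[leRHS]/(0%:E) -f0 Minfty_normE.
  by apply: ereal_sup_ubound; exists n.
have [mfn _ _] := mf.
have /measurable_EFinP mE := salg_measurable_fun (mfn n).
have := Lnorm_eq0_eq0 mE _ fn0; rewrite ltry => /(_ isT).
by apply: filterS => t /(_ I) [].
Qed.

HB.instance Definition _ := Lmodule_isNormed.Build R Minfty
  Minfty_normD Minfty_normZ Minfty_norm_eq0.

(* The value taken by f on D, for f constant on the nonempty set D; see
   [martingale_cell_const]. *)
Definition value_on (f : T -> R) (D : set T) : R :=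
  get [set v | forall t, D t -> f t = v].

Lemma value_onE (f : Minfty) n D t :
  cells F n D -> D t -> value_on (f n) D = f n t.
Proof.
move=> nD Dt; have /bounded_martingaleP[mf _] := mart_bounded f.
have /getPex : exists v, forall s, D s -> f n s = v.
  by exists (f n t) => s Ds; exact: (martingale_cell_const mf nD).
by move=> /(_ t Dt) ->.
Qed.

Definition branch_value (f : Minfty) (x : branches F) n : R :=
  value_on (f n) (branch_cell x n).

Definition branch_liminf (f : Minfty) (x : branches F) : \bar R :=
  limn_einf (fun n => (branch_value f x n)%:E).

Definition branch_limsup (f : Minfty) (x : branches F) : \bar R :=
  limn_esup (fun n => (branch_value f x n)%:E).

End martingales.

(* Main.v *)
Require Import Defs.
From mathcomp Require Import all_boot all_order all_algebra finmap.
From mathcomp Require Import all_classical all_reals all_analysis.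
From mathcomp Require Import borel_hierarchy ess_sup_inf measurable_realfun.
From mathcomp Require Import ring lra.

(** Write wild k for the set of pairs (f, x) such that f_n(x) - f_m(x) > 1/(k+1)
    for arbitrarily late n and m.  Since the values f_n(x) are bounded by the norm
    of f, the liminf is smaller than the limsup exactly when (f, x) belongs to
    some wild k ([limn_einf_lt_esupP]); and (f, x) |-> f_n(x) is continuous, so
    each wild k is an intersection of countably many open sets.  This gives the
    G_delta_sigma claim.

    Everything else rests on one bounded martingale h that oscillates by more than
    1/4 along a dense set of branches ([dense_oscillating_branches]).  It is the
    sequence of conditional densities P(A | D) of an event A such that every cell
    has subcells in which A fills at least 3/4 of the mass and subcells in which
    it fills at most 1/4 of it ([alternating_density]); by descending through such
    subcells alternately one finds, in every cell, a branch along which h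
    oscillates.  To build A, list the cells, choose in each of them a subcell
    whose mass is tiny with respect to the one chosen before, and alternately fill
    and empty the chosen subcells: the later changes are too small to spoil the
    earlier ones ([alternating_proportion]).  Subcells of arbitrarily small mass
    exist because every cell is eventually split ([small_cell]).

    Why the wild pairs are comeager ([comeager_oscillation]): given an open set of
    pairs, take k such that e = 1/(k+1) is small compared to its size.  Either
    wild k is dense in a part of the open set, or there are in it an f and an open
    set W of branches along each of which f eventually varies by at most e.  Then
    f + s h with a suitable small s, and also every martingale sufficiently close
    to it, oscillates by more than e along a dense set of branches in W.  In both
    cases some open part of the given open set lies in the closure of wild k.
    Hence the union over k of the interiors of these closures is dense, and inside
    the closure of wild k the open sets that define wild k are dense.

    The last claim follows from the first one by the Kuratowski-Ulam theorem,
    because the space of branches is second countable ([comeager_section]). *)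

Set Implicit Arguments.
Unset Strict Implicit.
Unset Printing Implicit Defensive.

Import Order.TTheory GRing.Theory Num.Theory.
Import numFieldNormedType.Exports.

Local Open Scope classical_set_scope.
Local Open Scope ring_scope.

(** * Meager sets *)

Section category.
Context {X : topologicalType}.
Implicit Type A : set X.

Lemma nowhere_denseP A : nowhere_dense A <->
  forall O, open O -> O `<=` closure A -> O = set0.
Proof.
split=> [A0 O oO OA|A0]; last first.
  exact: (A0 _ (open_interior _) (@interior_subset _ _)).
by rewrite -subset0 -A0 -open_subsetE.
Qed.

Lemma nowhere_dense_sub A B : A `<=` B -> nowhere_dense B -> nowhere_dense A.
Proof.
move=> AB /nowhere_denseP B0; apply/nowhere_denseP => O oO OA.
by apply: B0 => //; exact: subset_trans OA (closure_subset AB).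
Qed.

(** The union may be indexed by any countable set, and a subset of it is again
    an exact union of nowhere dense sets: cut each of them by the subset. *)
Lemma meager_bigcup (I : Type) (D : set I) (N : I -> set X) A :
  countable D -> (forall i, D i -> nowhere_dense (N i)) ->
  A `<=` \bigcup_(i in D) N i -> meager A.
Proof.
move=> /countable_injP[c cI] N0 AN.
exists (fun j => A `&` \bigcup_(i in D `&` c @^-1` [set j]) N i); last first.
  rewrite -setI_bigcupr; apply/esym/setIidl => t /AN[i Di Nit].
  by exists (c i) => //; exists i.
move=> j; have [[i [Di ij]]|nD] := pselect (exists i, D i /\ c i = j).
  apply: nowhere_dense_sub (N0 i Di) => t [_ [k [Dk kj]]].
  by rewrite -(cI k i) ?inE// ij.
apply: (nowhere_dense_sub (B := set0)); last first.
  by rewrite /nowhere_dense closure0; exact: interior0.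
by move=> t [_ [k kj _]]; apply: nD; exists k.
Qed.

End category.

(** Kuratowski-Ulam.  If a section of a nowhere dense set N is not nowhere dense,
    then its closure contains a nonempty basic open set U, so that the point x
    belongs to the closed set of those x for which {x} * U lies in the closure of
    N.  This closed set has empty interior, and there are only countably many
    choices of U. *)
Lemma comeager_section (X Y : topologicalType) (A : set (X * Y)) :
  @second_countable Y -> comeager A ->
  exists2 G : set X, comeager G &
    forall x, G x -> comeager [set y | A (x, y)].
Proof.
move=> [B cB [oB basisB]] [N N0 AN].
pose Q (p : nat * set Y) :=
  [set x | p.2 !=set0 /\ forall y, p.2 y -> closure (N p.1) (x, y)].
have clQ p : closure (Q p) `<=` Q p.
  move=> x cQx; have [_ [[p0 _] _]] := cQx _ filterT.
  split=> // y py; apply: closed_closure.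
  move=> V [[W1 W2] /= [W1x W2y] W]; have [x' [[_ Qx'] W1x']] := cQx _ W1x.
  exists (x', y); split; first exact: Qx'.
  by apply: W; split => //; exact: nbhs_singleton.
exists (~` \bigcup_(p in setT `*` B) Q p).
  rewrite /comeager setCK.
  apply: (meager_bigcup (D := setT `*` B)) => //; first exact: countableX.
  move=> p [_ /= Bp]; apply/nowhere_denseP => O oO /subset_trans/(_ (clQ p)) OQ.
  rewrite -subset0 => x Ox.
  have [[y py] _] := OQ x Ox.
  have /nowhere_denseP/(_ (O `*` p.2)) N1 := N0 p.1.
  suff /seteqP[H _] : O `*` p.2 = set0 by exact: (H (x, y)).
  apply: N1 => [|[x' y'] /= [/OQ[_ Qx'] py']]; last exact: Qx'.
  rewrite openE => -[x' y'] [Ox' py'].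
  by exists (O, p.2) => //=; split; apply: open_nbhs_nbhs; split => //; exact: oB.
  exact: subset_refl.
move=> x Gx; rewrite /comeager; 
  apply: (@meager_bigcup Y nat setT (fun i => [set y | N i (x, y)])) => //.
- move=> i _; apply/nowhere_denseP => O oO ON; rewrite -subset0 => y Oy.
  have [U [BU Uy] UO] := basisB y _ (open_nbhs_nbhs (conj oO Oy)).
  apply: Gx; exists (i, U) => //; split => //=; first by exists y.
  move=> z /UO/ON Nz V [[W1 W2] /= [W1x W2z] W].
  have [z' [Nz' W2z']] := Nz _ W2z.
  by exists (x, z'); split => //; apply: W; split => //; exact: nbhs_singleton.
- move=> y /= nA; have : (~` A) (x, y) by [].
  by rewrite AN => -[i _ Ni]; exists i.
Qed.

(** * Oscillating sequences *)

Definition oscillates {R : realType} (u : R^nat) (e : R) :=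
  forall N, exists n m, [/\ (N <= n)%N, (N <= m)%N & e < u n - u m].

(** The bound keeps the liminf and the limsup finite: a gap between infinite
    values could not be measured by a real number. *)
Lemma limn_einf_lt_esupP {R : realType} (u : R^nat) (M : R) :
  (forall n, `|u n| <= M) ->
  (limn_einf (EFin \o u) < limn_esup (EFin \o u))%E <->
  exists k, oscillates u k.+1%:R^-1.
Proof.
move=> uM; set v := EFin \o u.
have eS n : (einfs v n <= v n <= esups v n)%E.
  by apply/andP; split; [apply: ereal_inf_lbound|apply: ereal_sup_ubound];
    exists n => /=.
have geM n : (- M%:E <= einfs v n)%E.
  apply: le_ereal_inf_tmp => _ [m _ <-].
  by rewrite -EFinN lee_fin /=; have := uM m; rewrite ler_norml => /andP[].
have leM n : (esups v n <= M%:E)%E.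
  apply: ge_ereal_sup => _ [m _ <-].
  by rewrite lee_fin; have := uM m; rewrite ler_norml => /andP[].
have cI : limn (einfs v) = ereal_sup (range (einfs v)).
  by apply/cvg_lim => //; exact: cvg_einfs_sup.
have cS : limn (esups v) = ereal_inf (range (esups v)).
  by apply/cvg_lim => //; exact: cvg_esups_inf.
have Ile n : (einfs v n <= limn (einfs v))%E.
  by rewrite cI; apply: ereal_sup_ubound; exists n.
have leS n : (limn (esups v) <= esups v n)%E.
  by rewrite cS; apply: ereal_inf_lbound; exists n.
have IS := limn_einf_sup v; rewrite !limn_einf_lim !limn_esup_lim in IS *.
have finI : limn (einfs v) \is a fin_num.
  rewrite fin_numElt (lt_le_trans _ (le_trans (geM 0%N) (Ile 0%N)))//=.
    by rewrite (le_lt_trans IS)// (le_lt_trans (leS 0%N))//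
      (le_lt_trans (leM _))// ltry.
  by rewrite ltNyr.
have finS : limn (esups v) \is a fin_num.
  rewrite fin_numElt
    (lt_le_trans _ (le_trans (geM 0%N) (le_trans (Ile 0%N) IS)))//=.
    by rewrite (le_lt_trans (leS 0%N))// (le_lt_trans (leM _))// ltry.
  by rewrite ltNyr.
move: (fineK finI) (fineK finS) => fI fS.
set i := fine _ in fI; set s := fine _ in fS.
rewrite -fI -fS lte_fin; split=> [si|[k uk]]; last first.
  have k0 : 0 < (k.+1%:R^-1 : R) by rewrite invr_gt0.
  apply: (@lt_le_trans _ _ (i + k.+1%:R^-1)); first by rewrite ltrDl.
  rewrite -lee_fin EFinD fI fS.
  have cvI : (einfs v \+ cst (k.+1%:R^-1)%:E)%E @ \oo -->
      (limn (einfs v) + (k.+1%:R^-1)%:E)%E.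
    apply: cvgeD; [by rewrite fin_num_adde_defl| |exact: cvg_cst].
    exact: is_cvg_einfs.
  rewrite -(cvg_lim _ cvI)//; apply: lee_lim.
  - by apply/cvg_ex; eexists; exact: cvI.
  - exact: is_cvg_esups.
  apply: nearW => N /=; have [n [m [Nn Nm nm]]] := uk N.
  apply: (@le_trans _ _ (v n)); last by apply: ereal_sup_ubound; exists n.
  apply: (@le_trans _ _ (v m + (k.+1%:R^-1)%:E)%E).
    by rewrite leeD2r//; apply: ereal_inf_lbound; exists m.
  by rewrite -EFinD lee_fin -lerBrDl ltW.
have [k sik] : exists k, (k.+1%:R^-1 : R) < (s - i) / 3.
  have : 0 < (s - i) / 3 by lra.
  move=> e0; have [k _ /(_ k (leqnn _)) /=] := near_infty_natSinv_lt (PosNum e0).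
  by exists k.
(* a value within a third of the gap of the limsup, then one of the liminf *)
exists k => N.
have [_ [n Nn <-] /=] : exists2 y, [set v m | m in [set m | N <= m]%N] y &
    ((s - (s - i) / 3)%:E < y)%E.
  apply: ereal_sup_gt; apply: lt_le_trans (leS N).
  by rewrite -fS lte_fin; lra.
have [_ [m Nm <-] /=] : exists2 y, [set v m | m in [set m | N <= m]%N] y &
    (y < (i + (s - i) / 3)%:E)%E.
  apply: ereal_inf_lt; apply: le_lt_trans (Ile N) _.
  by rewrite -fI lte_fin; lra.
rewrite !lte_fin => um un; exists n, m; split => //.
by move: sik um un; set e := _^-1; lra.
Qed.

(** * Generic oscillation of linear families of sequences *)

Section generic_oscillation.
Context {R : realType} {M : normedModType R} {K : topologicalType}.
Variable v : M -> K -> nat -> R.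
Hypothesis vD : forall f g x n, v (f + g) x n = v f x n + v g x n.
Hypothesis vZ : forall a f x n, v (a *: f) x n = a * v f x n.
Hypothesis v_le : forall f x n, `|v f x n| <= `|f|.
Hypothesis v_cont : forall n, continuous (fun fx : M * K => v fx.1 fx.2 n).

Let late_gap k N := [set fx : M * K | exists n m,
  [/\ (N <= n)%N, (N <= m)%N & k.+1%:R^-1 < v fx.1 fx.2 n - v fx.1 fx.2 m]].

Let wild k := [set fx : M * K | oscillates (v fx.1 fx.2) k.+1%:R^-1].

Let wildE k : wild k = \bigcap_N late_gap k N.
Proof. by apply/seteqP; split=> fx h N => [_|]; exact: h. Qed.

Let open_late_gap k N : open (late_gap k N).
Proof.
rewrite (_ : late_gap k N =
  \bigcup_(p in [set p : nat * nat | (N <= p.1)%N /\ (N <= p.2)%N])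
    (fun fx => v fx.1 fx.2 p.1 - v fx.1 fx.2 p.2) @^-1`
      [set r | k.+1%:R^-1 < r]).
  apply: bigcup_open => p _; apply: open_comp; last exact: open_gt.
  by move=> fx _; apply: continuousB; exact: v_cont.
apply/seteqP; split=> [fx [n [m [Nn Nm h]]]|fx [[n m] /= [Nn Nm] h]].
  by exists (n, m).
by exists n, m.
Qed.

Lemma Gdelta_sigma_oscillation :
  Gdelta_sigma [set fx : M * K | exists k, oscillates (v fx.1 fx.2) k.+1%:R^-1].
Proof.
exists wild => [k|]; first by exists (late_gap k).
by apply/seteqP; split=> [fx [k h]|fx [k _ h]]; exists k.
Qed.

Variables (h : M) (c : R).
Hypothesis c_gt0 : 0 < c.
Hypothesis h_osc : dense [set x | oscillates (v h x) c].

(** A calm g in the open set is moved by s h.  Of the oscillation s c, at most e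
    is compensated by g and at most twice the radius s c / 4 by the distance to
    g + s h; what is left exceeds e < s c / 4. *)
Let somewhere_dense_wild O : open O -> O !=set0 ->
  exists k, exists2 O', open O' /\ O' !=set0 & O' `<=` O `&` closure (wild k).
Proof.
rewrite openE => oO [[f x] Ofx].
have [[U W] /= [Uf Wx] UWO] := oO _ Ofx.
have /nbhs_ballP[r /= r0 fU] := Uf.
have [W0 [oW0 W0x] W0W] : exists2 B, open_nbhs x B & B `<=` W.
  by rewrite nbhsE in Wx.
pose s := r / (2 * (`|h| + 1)).
have h0 : 0 <= `|h| by [].
have s0 : 0 < s by rewrite divr_gt0// mulr_gt0// ltr_wpDl.
have sh : `|s *: h| < r / 2.
  rewrite normrZ gtr0_norm// /s mulrAC ltr_pdivrMr ?mulr_gt0 ?ltr_wpDl//.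
  by move: (`|h|) h0 r0 => a a0 r0; nra.
have sc0 : 0 < s * c / 4 by rewrite divr_gt0// mulr_gt0.
have [k k0 ksc] :
    exists2 k, 0 < (k.+1%:R^-1 : R) & (k.+1%:R^-1 : R) < s * c / 4.
  have [k _ /(_ k (leqnn _)) /=] := near_infty_natSinv_lt (PosNum sc0).
  by exists k.
exists k; move: ksc k0; set e := _^-1 => ksc e0.
have r20 : 0 < r / 2 by rewrite divr_gt0.
have oX (V : set K) g t : open V -> open (ball (g : M) t `*` V).
  move=> oV; rewrite openE => -[g' y] /= [gg' Vy].
  exists (ball g t, V) => //=; split; last exact: open_nbhs_nbhs.
  by apply: open_nbhs_nbhs; split => //; exact: ball_open.
pose box := ball f (r / 2) `*` W0.
have boxO : box `<=` O.
  move=> [g y] [/= fg W0y]; apply: UWO; split; last exact: W0W.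
  by apply: fU; apply: le_ball fg; lra.
(* wild k is dense in the box, or some g in the box is calm on an open W3 *)
have [bk|] := pselect (box `<=` closure (wild k)).
  exists box => //; last by rewrite subsetI.
  by split; [exact: oX|exists (f, x); split => //=; exact: ballxx].
move=> /existsNP[[g y] /not_implyP[[/= fg W0y] ngy]].
have [[U2 W2] /= [U2g W2y] UW2] : nbhs (g, y) (~` closure (wild k)).
  by apply: open_nbhs_nbhs; split=> //; rewrite openC; exact: closed_closure.
have [W3 [oW3 W3y] W3W2] : exists2 B, open_nbhs y B & B `<=` W2.
  by rewrite nbhsE in W2y.
have calm z : W3 z -> exists N, forall n m, (N <= n)%N -> (N <= m)%N ->
    v g z n - v g z m <= e.
  move=> /W3W2 W2z; have : ~ wild k (g, z).
    move=> gz; apply: (UW2 (g, z)); first by split => //; exact: nbhs_singleton.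
    exact: subset_closure.
  move=> /existsNP[N hN]; exists N => n m Nn Nm.
  rewrite leNgt; apply/negP => gap.
  by apply: hN; exists n, m.
pose box2 := ball (g + s *: h) (s * c / 4) `*` (W0 `&` W3).
exists (box2 `&` O).
  split.
    apply: (@openI (M * K)%type); last by rewrite openE.
    by apply: oX; exact: openI.
  exists (g + s *: h, y); split; first by split => //=; exact: ballxx.
  apply: UWO; split => /=; last exact: W0W.
  apply: fU; rewrite -ball_normE /= opprD addrA.
  rewrite -ball_normE /= in fg.
  by rewrite (le_lt_trans (ler_normB _ _))//; lra.
move=> [f1 z] [[/= f1b [W0z W3z]] Oz]; split=> //.
move=> V [[U4 W4] /= [U4f1 W4z] UW4].
have [W5 [oW5 W5z] W5W4] : exists2 B, open_nbhs z B & B `<=` W4.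
  by rewrite nbhsE in W4z.
have [y' [[W3y' W5y'] osc]] :=
  h_osc (ex_intro _ z (conj W3z W5z)) (openI oW3 oW5).
exists (f1, y'); split; last first.
  by apply: UW4; split; [exact: nbhs_singleton|exact: W5W4].
move=> N; have [N' gN'] := calm _ W3y'.
have [n [m [nN mN hnm]]] := osc (maxn N N').
rewrite !geq_max in nN mN; case/andP: nN => Nn N'n; case/andP: mN => Nm N'm.
exists n, m; split => //=.
have f1E j : v f1 y' j = v g y' j + s * v h y' j + v (f1 - (g + s *: h)) y' j.
  by rewrite -vZ -!vD addrC subrK.
have small j : `|v (f1 - (g + s *: h)) y' j| < s * c / 4.
  apply: le_lt_trans (v_le _ _ _) _; rewrite distrC.
  by rewrite -ball_normE in f1b.
rewrite !f1E -/e; move: (gN' m n N'm N'n) (small n) (small m).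
rewrite !ltr_norml => gmn /andP[? ?] /andP[? ?].
have : s * c < s * (v h y' n - v h y' m) by rewrite ltr_pM2l.
by rewrite mulrBr; lra.
Qed.

(** The complement is covered by the sets closure (wild k) minus late_gap k n,
    a nonempty open part of which would meet wild k inside late_gap k n, and by
    the complement of the union of the closures, which is nowhere dense by
    [somewhere_dense_wild]. *)
Lemma comeager_oscillation :
  comeager [set fx : M * K | exists k, oscillates (v fx.1 fx.2) k.+1%:R^-1].
Proof.
pose N (p : option (nat * nat)) := if p is Some (k, n)
  then closure (wild k) `\` late_gap k n else ~` \bigcup_k closure (wild k).
rewrite /comeager; apply: (meager_bigcup (D := setT) (N := N)) => //.
- case=> [[k n] _|_]; apply/nowhere_denseP => O oO ON; rewrite -subset0 => p Op.
  + have cN : closed (N (Some (k, n))).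
      apply: closedI; first exact: closed_closure.
      exact: open_closedC.
    have ON' : O `<=` N (Some (k, n)) by move=> q /ON /cN.
    have [q [gq Oq]] := (ON' _ Op).1 _ (open_nbhs_nbhs (conj oO Op)).
    by apply: (ON' _ Oq).2; move: gq; rewrite wildE; apply.
  + have [k [V [oV [q Vq]] VO]] := somewhere_dense_wild oO (ex_intro _ p Op).
  have [q' [nq' Vq']] := ON _ (VO _ Vq).1 _ (open_nbhs_nbhs (conj oV Vq)).
  by apply: nq'; exists k => //; exact: (VO _ Vq').2.
- move=> p np.
  have [[k _ pk]|nc] := pselect ((\bigcup_k closure (wild k)) p); last first.
    by exists None.
  have : ~ wild k p by move=> gp; apply: np; exists k.
  rewrite wildE => /existsNP[n /not_implyP[_ ng]].
  by exists (Some (k, n)).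
Qed.

End generic_oscillation.

(** * Cells and the space of branches *)

Section cells.
Context d (T : measurableType d) (R : realType) (P : probability T R).
Variable F : finite_filtration P.
Implicit Types (n m : nat) (s t : T) (D : set T).

Definition cell n t : set T := [set s | exists D, [/\ cells F n D, D t & D s]].

Lemma cell_unique n D t : cells F n D -> D t -> cell n t = D.
Proof.
move=> nD Dt; have [_ tr _] := cells_partition F n.
apply/seteqP; split=> [s [D' [nD' D't D's]]|s Ds]; last by exists D.
by rewrite -(tr D' D nD' nD)//; exists t.
Qed.

Lemma cells_cell n t : cells F n (cell n t).
Proof.
have [cov _ _] := cells_partition F n.
have [D nD Dt] : cover (cells F n) id t by rewrite cov.
by rewrite (cell_unique nD Dt).
Qed.

Lemma cell_refl n t : cell n t t.
Proof.
have [cov _ _] := cells_partition F n.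
by have [D nD Dt] : cover (cells F n) id t by [rewrite cov]; exists D.
Qed.

Lemma cellsP n D : cells F n D -> exists t, D = cell n t.
Proof.
move=> nD; have [_ _ ne] := cells_partition F n.
have [t Dt] := ne D nD.
by exists t; rewrite (cell_unique nD Dt).
Qed.

Lemma cell_eq n s t : cell n t s -> cell n s = cell n t.
Proof. by move=> ts; apply: cell_unique => //; exact: cells_cell. Qed.

Lemma sub_cell n m t : (n <= m)%N -> cell m t `<=` cell n t.
Proof.
move=> nm; have := salg_cells (salg_incr nm (cells_salg (cells_cell n t)))
  (cells_cell m t).
by case=> // /(_ t (cell_refl _ _)) /(_ (cell_refl _ _)).
Qed.

Lemma measurable_cell n t : measurable (cell n t).
Proof. exact/(salg_measurable (n := n))/cells_salg/cells_cell. Qed.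

Lemma cell_gt0 n t : (0 < P (cell n t))%E.
Proof. exact/cells_gt0/cells_cell. Qed.

Implicit Types x y : branches F.

Lemma cells_branch_cell x n : cells F n (branch_cell x n).
Proof. by rewrite /branch_cell /cell_at; exact: set_valP. Qed.

Lemma sub_branch_cell x n m :
  (n <= m)%N -> branch_cell x m `<=` branch_cell x n.
Proof. by move=> nm; have := set_valP x; exact. Qed.

Lemma branch_cellP x n : exists t, branch_cell x n = cell n t.
Proof. by have [t] := cellsP (cells_branch_cell x n); exists t. Qed.

Lemma branch_cell_eq_le x y n m : (m <= n)%N ->
  branch_cell x n = branch_cell y n -> branch_cell x m = branch_cell y m.
Proof.
move=> mn xy; have [t xnt] := branch_cellP x n.
have xt : branch_cell x m t.
  by apply: (sub_branch_cell mn); rewrite xnt; exact: cell_refl.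
have yt : branch_cell y m t.
  by apply: (sub_branch_cell mn); rewrite -xy xnt; exact: cell_refl.
by rewrite -(cell_unique (cells_branch_cell x m) xt)
  -(cell_unique (cells_branch_cell y m) yt).
Qed.

Definition cylinder n D : set (branches F) := [set x | branch_cell x n = D].

Lemma open_cylinder n D : open (cylinder n D).
Proof.
have pc : continuous (fun x : branches F => (set_val x : cell_product F) n).
  move=> x; apply: (@continuous_comp _ (cell_product F) _ set_val (fun z => z n)).
    exact: initial_continuous.
  exact: (@proj_continuous _ (fun k => discrete_topology (cells F k)) n).
rewrite (_ : cylinder n D = (fun x : branches F => (set_val x : cell_product F) n)
   @^-1` [set E : discrete_topology (cells F n) | set_val (E : cells F n) = D])//.
by move/continuousP: pc; apply; exact: discrete_open.
Qed.

(** Cells along a branch decrease, so a single coordinate determines all the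
    earlier ones and a cylinder is a basic open set of the product topology. *)
Lemma nbhs_cylinder x (U : set (branches F)) : nbhs x U ->
  exists n, cylinder n (branch_cell x n) `<=` U.
Proof.
move=> [_ [[W oW <-] Wx WU]].
pose agree n := [set z : cell_product F |
  forall k, (k <= n)%N -> z k = (set_val x : cell_product F) k].
have Ff : Filter (filter_from [set: nat] agree).
  apply: filter_from_filter; first by exists 0%N.
  move=> i j _ _; exists (maxn i j) => // z zx.
  by split=> k ki; apply: zx; rewrite leq_max ki ?orbT.
have : filter_from [set: nat] agree --> (set_val x : cell_product F).
  apply/cvg_sup => i V [_ [[B oB <-] Bx BV]].
  by exists i => // z zx; apply: BV => /=; rewrite zx.
move=> /(_ W) /= [|n _ nW]; first exact: open_nbhs_nbhs.
exists n => y yx; apply: WU => /=; apply: nW => k kn.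
by apply: val_inj; exact: branch_cell_eq_le kn yx.
Qed.

Lemma branches_second_countable : @second_countable (branches F).
Proof.
exists (\bigcup_n (cylinder n @` cells F n)).
  apply: bigcup_countable => // n _; 
  exact/finite_set_countable/finite_image/cells_finite.
split=> [_ [n _ [D _ <-]]|x U /nbhs_cylinder[n nU]]; first exact: open_cylinder.
exists (cylinder n (branch_cell x n)) => //; split=> //.
by exists n => //; exists (branch_cell x n) => //; exact: cells_branch_cell.
Qed.

Lemma branch_of_points (tau : nat -> T) :
  (forall k j, (k <= j)%N -> cell k (tau k) (tau j)) ->
  exists x, forall n, branch_cell x n = cell n (tau n).
Proof.
move=> tauP.
pose z : cell_product F := fun n => SigSub (mem_set (cells_cell n (tau n))).
have zE n : cell_at z n = cell n (tau n) by [].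
have bz : branch_set z.
  by move=> n m nm; rewrite !zE -(cell_eq (tauP n m nm)); exact: sub_cell.
by exists (SigSub (mem_set bz)).
Qed.

Lemma branch_valueE (f : Minfty F) x n t :
  branch_cell x n t -> branch_value f x n = mart f n t.
Proof. exact/value_onE/cells_branch_cell. Qed.

(** An essential bound is a bound on each cell, since cells have positive
    probability. *)
Lemma branch_value_le_norm (f : Minfty F) x n : `|branch_value f x n| <= `|f|.
Proof.
have [t xt] := branch_cellP x n.
have xtt : branch_cell x n t by rewrite xt; exact: cell_refl.
rewrite (branch_valueE f xtt).
have /bounded_martingaleP[mf bf] := mart_bounded f.
rewrite -lee_fin -[X in (_ <= X)%E]/((Minfty_norm f)%:E) Minfty_normE.
apply: (@le_trans _ _ ('N[P]_+oo[EFin \o f n])%E); last first.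
  by apply: ereal_sup_ubound; exists n.
rewrite leNgt; apply/negP => fn.
have := cell_gt0 n t; rewrite lt0e => /andP[/eqP + _]; apply.
apply/(negligibleP P (measurable_cell n t)).
have := ess_sup_ge P (abse \o (EFin \o f n)); apply: negligibleS => s st /=.
rewrite (martingale_cell_const mf (cells_cell n t) st (cell_refl n t)).
apply/negP; rewrite -ltNge; apply: le_lt_trans fn.
have P0 : (0 < P [set: T])%E by rewrite probability_setT lte01.
by rewrite unlock /Lnorm P0.
Qed.

Lemma branch_valueD (f g : Minfty F) x n :
  branch_value (f + g) x n = branch_value f x n + branch_value g x n.
Proof.
have [t xt] := branch_cellP x n.
have xtt : branch_cell x n t by rewrite xt; exact: cell_refl.
by rewrite !(branch_valueE _ xtt).
Qed.

Lemma branch_valueZ a (f : Minfty F) x n :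
  branch_value (a *: f) x n = a * branch_value f x n.
Proof.
have [t xt] := branch_cellP x n.
have xtt : branch_cell x n t by rewrite xt; exact: cell_refl.
by rewrite !(branch_valueE _ xtt).
Qed.

Lemma branch_value_continuous n :
  continuous (fun fx : Minfty F * branches F => branch_value fx.1 fx.2 n).
Proof.
move=> [f x]; apply/cvgrPdist_lt => e e0.
exists (ball f e, cylinder n (branch_cell x n)) => /=.
  split; first exact: nbhsx_ballx.
  by apply: open_nbhs_nbhs; split=> //; exact: open_cylinder.
move=> [g y] /= [fg yx].
have -> : branch_value g y n = branch_value g x n by rewrite /branch_value yx.
rewrite -mulN1r -branch_valueZ -branch_valueD scaleN1r.
by apply: le_lt_trans (branch_value_le_norm _ _ _) _; rewrite -ball_normE in fg.
Qed.

End cells.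

(** * Conditional densities of an event *)

(** A consists of the points for which the last C j that contains them has an even
    index j.  Within C j this can differ from the parity of j only on the union of
    the later sets, whose total mass is at most P (C j) (1/8 + 1/64 + ...), hence
    at most P (C j) / 4. *)
Lemma alternating_proportion d (T : measurableType d) (R : realType)
    (P : probability T R) (C : nat -> set T) :
  (forall j, measurable (C j)) ->
  (forall j, (P (C j.+1) <= (8^-1)%:E * P (C j))%E) ->
  exists2 A, measurable A & forall j,
    if odd j then (P (A `&` C j) <= (4^-1)%:E * P (C j))%E
    else ((3 / 4)%:E * P (C j) <= P (A `&` C j))%E.
Proof.
move=> mC C8; pose U j := \bigcup_i C (j.+1 + i)%N.
have mU j : measurable (U j) by exact: bigcup_measurable.
have CE j : P (C j) = (fine (P (C j)))%:E by rewrite fineK// fin_num_measure.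
have C8n j i : (P (C (j.+1 + i)%N) <=
    (4^-1 * fine (P (C j)) / (2 ^ i.+1)%:R)%:E)%E.
  elim: i => [|i IH].
    apply: le_trans (_ : ((8^-1)%:E * P (C j))%E <= _)%E; first by rewrite addn0.
    rewrite CE -EFinM lee_fin expn1; have := fine_ge0 (measure_ge0 P (C j)); lra.
  rewrite addnS; apply: le_trans (C8 _) _.
  have -> : 4^-1 * fine (P (C j)) / (2 ^ i.+2)%:R =
      2^-1 * (4^-1 * fine (P (C j)) / (2 ^ i.+1)%:R).
    by rewrite [(2 ^ i.+2)%N]expnS natrM invfM; ring.
  rewrite EFinM; apply: le_trans (lee_wpmul2l _ IH); last by rewrite lee_fin.
  apply: lee_wpmul2r => //; rewrite lee_fin; lra.
have PU j : (P (U j) <= (4^-1)%:E * P (C j))%E.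
  apply: (@le_trans _ _ (\sum_(0 <= i <oo) P (C (j.+1 + i)%N))%E).
    exact: measure_sigma_subadditive.
  have c0 : 0 <= 4^-1 * fine (P (C j)) by rewrite mulr_ge0// fine_ge0.
  rewrite CE -EFinM; apply: le_trans (epsilon_trick0 xpredT c0).
  by apply: lee_nneseries => // i _; exact: C8n.
exists (\bigcup_(j in [set j | ~~ odd j]) (C j `\` U j)).
  by apply: bigcup_measurable => j _; exact: measurableD.
move=> j; case: ifPn => oj.
  apply: le_trans (PU j); apply: le_measure; rewrite ?inE//.
    apply: measurableI => //; apply: bigcup_measurable => i _.
    exact: measurableD.
  move=> t [[i /= oi [Cit Uit]] Cjt].
  have [ji|ij|ij] := ltngtP j i.
  - by exists (i - j.+1)%N => //; rewrite subnKC.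
  - by exfalso; apply: Uit; exists (j - i.+1)%N => //; rewrite subnKC.
  - by move: oi; rewrite -ij oj.
apply: (@le_trans _ _ (P (C j `\` U j))).
  have -> : P (C j `\` U j) = (P (C j) - P (C j `&` U j))%E.
    apply: measureD => //; apply: le_lt_trans (probability_le1 P (mC j)) _.
    exact: ltry.
  have : (P (C j `&` U j) <= (4^-1)%:E * P (C j))%E.
    apply: le_trans (PU j); apply: le_measure; rewrite ?inE//.
    exact: measurableI.
  have /fineK <- : P (C j `&` U j) \is a fin_num.
    by rewrite fin_num_measure//; exact: measurableI.
  by rewrite CE -!EFinM -EFinB !lee_fin; lra.
apply: le_measure; rewrite ?inE; [exact: measurableD| |].
  by apply: measurableI => //; apply: bigcup_measurable => i _; exact: measurableD.
by move=> t [Ct Ut]; split=> //; exists j.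
Qed.

Section density.
Context d (T : measurableType d) (R : realType) (P : probability T R).
Variable F : finite_filtration P.

Lemma salg_bigcup n E : salg F n E ->
  E = \bigcup_(D in [set D | cells F n D /\ D `<=` E]) D.
Proof.
move=> nE; apply/seteqP; split=> [t Et|t [D [_ DE] Dt]]; last exact: DE.
exists (cell F n t); last exact: cell_refl.
split; first exact: cells_cell.
by have [//|/(_ t (cell_refl _ _ _))] := salg_cells nE (cells_cell F n t).
Qed.

Lemma measurable_fun_cell_const n (g : T -> R) :
  (forall s t, cell F n t s -> g s = g t) ->
  measurable_fun [set: g_sigma_algebraType (salg F n)] g.
Proof.
move=> gc _ B _; rewrite setTI.
have -> : g @^-1` B = \bigcup_(D in [set D | cells F n D /\ D `<=` g @^-1` B]) D.
  apply/seteqP; split=> [t Bt|t [D [_ DB] Dt]]; last exact: DB.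
  exists (cell F n t); last exact: cell_refl.
  by split; [exact: cells_cell|move=> s /gc/= ->].
apply: fin_bigcup_measurable.
  by apply: sub_finite_set (cells_finite F n) => D [].
by move=> D [nD _]; apply: sub_sigma_algebra; exact: cells_salg.
Qed.

(** Sets of the n-th sigma-algebra are finite disjoint unions of cells. *)
Lemma integral_salg_eq n (f g : T -> \bar R) E :
  measurable_fun [set: T] f -> measurable_fun [set: T] g ->
  (forall t, 0 <= f t)%E -> (forall t, 0 <= g t)%E ->
  (forall t, \int[P]_(s in cell F n t) f s = \int[P]_(s in cell F n t) g s)%E ->
  salg F n E -> (\int[P]_(s in E) f s = \int[P]_(s in E) g s)%E.
Proof.
move=> mf mg f0 g0 fg nE.
set S := [set D | cells F n D /\ D `<=` E].
have Sfin : finite_set S by apply: sub_finite_set (cells_finite F n) => D [].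
(* the default value makes all members of the family G measurable *)
pose G D := if D \in cells F n then D else set0.
have mG D : measurable (G D).
  rewrite /G; case: ifPn => // /set_mem nD.
  by apply: (@salg_measurable _ _ _ _ F n); exact: cells_salg.
have EG : E = \big[setU/set0]_(D <- fset_set S) G D.
  rewrite -bigcup_fset fset_setK// [LHS](salg_bigcup nE).
  by apply: eq_bigcupr => D [nD _]; rewrite /G mem_set.
have tG : trivIset [set` fset_set S] G.
  rewrite fset_setK// => D D' [nD _] [nD' _]; rewrite /G !mem_set//.
  by have [_ tr _] := cells_partition F n; exact: tr.
have sub h : measurable_fun [set: T] h -> measurable_fun E (h : T -> \bar R).
  exact: measurable_funS.
rewrite EG !ge0_integral_bigsetU//; try by rewrite -EG; exact: sub.
rewrite !big_seq; apply: eq_bigr => D.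
rewrite in_fset_set// => /set_mem[nD _]; rewrite /G mem_set//.
by have [t ->] := cellsP nD.
Qed.

Variable A : set T.
Hypothesis mA : measurable A.

Definition density n t : R :=
  fine (P (A `&` cell F n t)) / fine (P (cell F n t)).

Lemma prob_cell n t : P (cell F n t) = (fine (P (cell F n t)))%:E.
Proof. by rewrite fineK// fin_num_measure//; exact: measurable_cell. Qed.

Lemma prob_cell_gt0 n t : 0 < fine (P (cell F n t)).
Proof. by rewrite -lte_fin -prob_cell; exact: cell_gt0. Qed.

Lemma densityE n t :
  ((density n t)%:E * P (cell F n t) = P (A `&` cell F n t))%E.
Proof.
rewrite /density prob_cell -EFinM -mulrA mulVf ?mulr1; last first.
  by rewrite gt_eqF//; exact: prob_cell_gt0.
by rewrite fineK// fin_num_measure//; apply: measurableI => //; exact: measurable_cell.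
Qed.

Lemma density_ge0 n t : 0 <= density n t.
Proof. by rewrite divr_ge0// fine_ge0. Qed.

Lemma density_le1 n t : density n t <= 1.
Proof.
rewrite ler_pdivrMr ?prob_cell_gt0// mul1r -lee_fin -prob_cell.
have mc := measurable_cell F n t.
rewrite fineK ?fin_num_measure//; last exact: measurableI.
by apply: le_measure; rewrite ?inE//; exact: measurableI.
Qed.

Lemma density_cell n s t : cell F n t s -> density n s = density n t.
Proof. by move=> ts; rewrite /density (cell_eq ts). Qed.

Lemma measurable_density n : measurable_fun [set: T] (density n).
Proof.
by apply: (@salg_measurable_fun _ _ _ _ F n); apply: measurable_fun_cell_const;
  exact: density_cell.
Qed.

(** The right-hand side does not depend on n: this is the martingale property. *)
Lemma integral_density n E : salg F n E ->
  (\int[P]_(t in E) (density n t)%:E = \int[P]_(t in E) (\1_A t)%:E)%E.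
Proof.
apply: integral_salg_eq => [| |t|t|t].
- by apply/measurable_EFinP; exact: measurable_density.
- by apply/measurable_EFinP; exact: measurable_indic.
- by rewrite lee_fin density_ge0.
- by rewrite lee_fin.
- have mc := measurable_cell F n t.
  rewrite (eq_integral (cst (density n t)%:E)); last first.
    by move=> s /set_mem/density_cell ->.
  by rewrite integral_cst// integral_indic// densityE.
Qed.

Lemma martingale_density : martingale F density.
Proof.
split=> [n|n|n m E nm nE].
- by apply: measurable_fun_cell_const; exact: density_cell.
- apply: measurable_bounded_integrable => //.
  + by apply: (le_lt_trans (probability_le1 P measurableT)); exact: ltry.
  + exact: measurable_density.
  + exists 1; split => // M M1 t _ /=.
    by rewrite ger0_norm ?density_ge0// (le_trans (density_le1 n t))// ltW.
- by rewrite !integral_density//; exact: salg_incr nE.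
Qed.

Lemma bounded_martingale_density : density \in bounded_martingale F.
Proof.
apply/bounded_martingaleP; split; first exact: martingale_density.
apply: (@le_lt_trans _ _ 1%E); last exact: ltry.
apply: ge_ereal_sup => _ [n _ <-].
have P0 : (0 < P [set: T])%E by rewrite probability_setT lte01.
rewrite unlock /Lnorm P0; apply/ess_supP; apply: nearW => t /=.
by rewrite lee_fin ger0_norm ?density_ge0// density_le1.
Qed.

Definition density_martingale : Minfty F := MInfty bounded_martingale_density.

End density.

(** * A martingale oscillating along a dense set of branches *)

Section oscillating_martingale.
Context d (T : measurableType d) (R : realType) (P : probability T R).
Variable F : finite_filtration P.

(** At the level where the cell has been split it contains two disjoint cells;
    the lighter of the two has at most half of the mass. *)
Lemma cell_halving n t : exists m s, [/\ (n <= m)%N, cell F n t s &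
  (P (cell F m s) <= (2^-1)%:E * P (cell F n t))%E].
Proof.
have [m nm nmt] := cells_split (cells_cell F n t).
have [u ntu mtu] : exists2 u, cell F n t u & ~ cell F m t u.
  apply: contrapT => /forall2NP h; apply: nmt.
  suff -> : cell F n t = cell F m t by exact: cells_cell.
  apply/seteqP; split=> [s nts|]; last exact/sub_cell/ltnW.
  by have [//|/contrapT] := h s.
have mc k s := measurable_cell F k s.
have : (P (cell F m t) + P (cell F m u) <= P (cell F n t))%E.
  rewrite -measureU//; last first.
    apply/seteqP; split=> // s [mts mus]; apply: mtu.
    by rewrite -(cell_eq mts) (cell_eq mus); exact: cell_refl.
  apply: le_measure; rewrite ?inE//; first exact: measurableU.
  move=> s [|]; first exact/sub_cell/ltnW.
  by rewrite -(cell_eq ntu); exact/sub_cell/ltnW.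
rewrite (prob_cell F m t) (prob_cell F m u) (prob_cell F n t) -EFinD lee_fin => tu.
have [tle|tgt] := leP (fine (P (cell F m t))) (2^-1 * fine (P (cell F n t))).
  exists m, t; split; [exact: ltnW|exact: cell_refl|].
  by rewrite (prob_cell F m t) (prob_cell F n t) -EFinM lee_fin.
exists m, u; split=> //; first exact: ltnW.
by rewrite (prob_cell F m u) (prob_cell F n t) -EFinM lee_fin; lra.
Qed.

Lemma small_cell n t (e : R) : 0 < e -> exists m s,
  [/\ (n <= m)%N, cell F n t s & (P (cell F m s) <= e%:E)%E].
Proof.
move=> e0.
have small k : exists m s, [/\ (n <= m)%N, cell F n t s &
    (P (cell F m s) <= (2^-1 ^+ k)%:E)%E].
  elim: k => [|k [m [s [nm nts msk]]]].
    exists n, t; split=> //; first exact: cell_refl.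
    by rewrite expr0 probability_le1//; exact: measurable_cell.
  have [m' [s' [mm' mss' half]]] := cell_halving m s.
  exists m', s'; split; first exact: leq_trans mm'.
    by rewrite -(cell_eq nts); exact: (sub_cell nm).
  by apply: (le_trans half); rewrite exprS EFinM lee_wpmul2l// lee_fin.
have [k ke] : exists k, 2^-1 ^+ k < e.
  have /cvgrPdist_lt/(_ e e0)[k _ /(_ k (leqnn _))] :
      (fun k => (2^-1 : R) ^+ k) @ \oo --> (0 : R).
    by apply: cvg_expr; rewrite gtr0_norm ?invf_lt1// ltr1n.
  by rewrite sub0r normrN ger0_norm ?exprn_ge0//; exists k.
have [m [s [nm nts msk]]] := small k.
by exists m, s; split=> //; apply: (le_trans msk); rewrite lee_fin ltW.
Qed.

Lemma cells_enum : exists q : nat -> nat * T,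
  forall n t, exists j, (q j).1 = n /\ cell F n (q j).2 = cell F n t.
Proof.
have /countable_injP[c cI] :
    countable (\bigcup_n (pair n @` cells F n) : set (nat * set T)).
  apply: bigcup_countable => // n _.
  exact/finite_set_countable/finite_image/cells_finite.
have [t0 _] : [set: T] !=set0.
  apply/set0P/eqP => T0; have := probability_setT P.
  by rewrite T0 measure0 => /eqP; rewrite eq_sym onee_eq0.
have cS n t : (n, cell F n t) \in \bigcup_n (pair n @` cells F n).
  by rewrite inE; exists n => //; exists (cell F n t) => //; exact: cells_cell.
have /choice[q qP] : forall j, exists p : nat * T,
    (exists n t, c (n, cell F n t) = j) -> c (p.1, cell F p.1 p.2) = j.
  move=> j; have [[n [t nt]]|no] := pselect (exists n t, c (n, cell F n t) = j).
    by exists (n, t).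
  by exists (0%N, t0).
exists q => n t; exists (c (n, cell F n t)).
have /cI := qP (c (n, cell F n t)) (ex_intro _ n (ex_intro _ t erefl)).
by case/(_ (cS _ _) (cS _ _)) => -> ->.
Qed.

(** The j-th cell of a list of all the cells is the target of the two indices 2j
    and 2j + 1 of [alternating_proportion], once for each parity. *)
Lemma alternating_density : exists2 A, measurable A &
  forall n t (b : bool), exists m s, [/\ (n <= m)%N, cell F n t s &
    if b then density F A m s <= 4^-1 else 3 / 4 <= density F A m s].
Proof.
have [q qP] := cells_enum.
have /choice[g gP] : forall x : (nat * T) * {posnum R}, exists ms : nat * T,
    [/\ (x.1.1 <= ms.1)%N, cell F x.1.1 x.1.2 ms.2 &
        (P (cell F ms.1 ms.2) <= x.2%:num%:E)%E].
  move=> [[n t] e]; have [m [s h]] := small_cell n t (gt0 e).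
  by exists (m, s).
have e0 (p : nat * T) : 0 < fine (P (cell F p.1 p.2)) / 8.
  by rewrite divr_gt0// prob_cell_gt0.
pose st := fix st j := if j is j'.+1 then g (q j./2, PosNum (e0 (st j')))
                       else g (q 0%N, PosNum ltr01).
pose C j := cell F (st j).1 (st j).2.
have [||A mA AP] := @alternating_proportion _ _ _ P C.
- by move=> j; exact: measurable_cell.
- move=> j; have [_ _ /= small] := gP (q j.+1./2, PosNum (e0 (st j))).
  apply: (le_trans small).
  by rewrite [in leRHS]/C [in leRHS]prob_cell -EFinM mulrC.
have stP j : ((q j./2).1 <= (st j).1)%N /\ cell F (q j./2).1 (q j./2).2 (st j).2.
  case: j => [|j]; first by have [] := gP (q 0%N, PosNum ltr01).
  by have [] := gP (q j.+1./2, PosNum (e0 (st j))).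
exists A => // n t b; have [j [<- qt]] := qP n t.
have jb : (b + j.*2)./2 = j by exact: half_bit_double.
exists (st (b + j.*2)%N).1, (st (b + j.*2)%N).2; split.
- by have := (stP (b + j.*2)%N).1; rewrite jb.
- by rewrite -qt; have := (stP (b + j.*2)%N).2; rewrite jb.
- have := AP (b + j.*2)%N; rewrite oddD odd_double addbF oddb.
  set m := (st _).1; set s := (st _).2.
  rewrite -[P (A `&` _)](densityE F mA m s) -/(C _).
  rewrite [P (C _)](prob_cell F m s) -!EFinM !lee_fin.
  by rewrite !ler_pM2r// prob_cell_gt0.
Qed.

(** The state is a cell, given by its level and one of its points.  From any cell
    one descends to a deeper one with low or high density, in turn.  Since the
    level of the k-th state is at least k, the k-th point fixes the k-th cell of
    the branch. *)
Lemma dense_oscillating_branches : exists h : Minfty F,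
  dense [set x : branches F | oscillates (branch_value h x) 4^-1].
Proof.
have [A mA AP] := alternating_density.
exists (density_martingale F mA) => O [x Ox] oO.
have [n nO] := nbhs_cylinder (open_nbhs_nbhs (conj oO Ox)).
have [t xt] := branch_cellP x n.
have /choice[g gP] : forall y : (nat * T) * bool, exists ms : nat * T,
    [/\ (y.1.1 < ms.1)%N, cell F y.1.1 y.1.2 ms.2 &
     if y.2 then density F A ms.1 ms.2 <= 4^-1 else 3 / 4 <= density F A ms.1 ms.2].
  move=> [[k s] b]; have [m [u [km ksu h]]] := AP k.+1 s b.
  by exists (m, u); split=> //; exact: (sub_cell (leqnSn k)).
pose st := fix st j := if j is j'.+1 then g (st j', odd j') else (n, t).
have st_lt j : ((st j).1 < (st j.+1).1)%N by have [] := gP (st j, odd j).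
have st_ge j : (j <= (st j).1)%N.
  by elim: j => // j IH; exact: leq_ltn_trans (st_lt j).
have st_mono j i : ((st j).1 <= (st (j + i)%N).1)%N.
  by elim: i => [|i IH]; rewrite ?addn0// addnS (leq_trans IH)// ltnW.
have st_sub j i : cell F (st j).1 (st j).2 (st (j + i)%N).2.
  elim: i => [|i IH]; first by rewrite addn0; exact: cell_refl.
  have [_ + _] := gP (st (j + i)%N, odd (j + i)).
  by rewrite addnS -(cell_eq IH); exact/sub_cell/st_mono.
have [k j kj|y yE] := branch_of_points (F := F) (tau := fun k => (st k).2).
  by apply: (sub_cell (st_ge k)); have := st_sub k (j - k)%N; rewrite subnKC.
have y_st j : branch_cell y (st j).1 = cell F (st j).1 (st j).2.
  rewrite yE; apply: cell_eq.
  by have := st_sub j ((st j).1 - j)%N; rewrite subnKC.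
exists y; split; first by apply: nO; rewrite /cylinder /= xt; exact: y_st 0%N.
have val j : branch_value (density_martingale F mA) y (st j).1 =
    density F A (st j).1 (st j).2.
  by rewrite (branch_valueE _ (t := (st j).2))// y_st; exact: cell_refl.
(* step j + 1 has high density for even j and low density for odd j *)
move=> N; exists (st N.*2.+1).1, (st N.*2.+2).1; split.
- by apply: leq_trans (st_ge _); rewrite -addnn -addnS leq_addr.
- by apply: leq_trans (st_ge _); rewrite -addnn -!addnS leq_addr.
rewrite !val.
have [_ _ /= hi] := gP (st N.*2, odd N.*2).
have [_ _ /= lo] := gP (st N.*2.+1, odd N.*2.+1).
by move: hi lo; rewrite odd_double /=; lra.
Qed.

End oscillating_martingale.

Theorem theorem4p6 (d : measure_display) (T : measurableType d) (R : realType)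
    (P : probability T R) (F : finite_filtration P) :
  [/\ comeager [set fx : Minfty F * branches F |
        (branch_liminf fx.1 fx.2 < branch_limsup fx.1 fx.2)%E],
      Gdelta_sigma [set fx : Minfty F * branches F |
        (branch_liminf fx.1 fx.2 < branch_limsup fx.1 fx.2)%E]
    & exists2 G : set (Minfty F), comeager G &
        forall f, G f -> exists2 H : set (branches F), comeager H &
          forall x, H x -> (branch_liminf f x < branch_limsup f x)%E].
Proof.
have E : [set fx : Minfty F * branches F |
      (branch_liminf fx.1 fx.2 < branch_limsup fx.1 fx.2)%E] =
    [set fx | exists k, oscillates (branch_value fx.1 fx.2) k.+1%:R^-1].
  apply/funext => fx; apply/propext.
  exact: limn_einf_lt_esupP (branch_value_le_norm fx.1 fx.2).
have [h h_osc] := dense_oscillating_branches F.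
have gen : comeager [set fx : Minfty F * branches F |
      (branch_liminf fx.1 fx.2 < branch_limsup fx.1 fx.2)%E].
  rewrite E; apply: (comeager_oscillation _ _ _ _ _ h_osc).
  - by move=> f g x n; exact: branch_valueD.
  - by move=> a f x n; exact: branch_valueZ.
  - by move=> f x n; exact: branch_value_le_norm.
  - by move=> n; exact: branch_value_continuous.
  - by [].
split=> //.
  by rewrite E; apply: Gdelta_sigma_oscillation => n; exact: branch_value_continuous.
have [G mG GP] := comeager_section (branches_second_countable F) gen.
by exists G => // f Gf; eexists; first exact: GP Gf.
Qed.
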